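(* Fix the Cartesian grid (hence the step size $h_C>0$) and the matrix $\mathsf{S}^{(C)}\in\mathbb{C}^{N_C\times N_C}$. Let $h>0$ be an arbitrary mesh size, let $\mathcal{T}$ be any triangulation of $\Omega$ of mesh size $h$ with quadrature nodes $y_1,\dots,y_{N_Q}\in\Omega$, and let $\mathsf{T}_C^Q$, $\mathsf{D}$, $\mathsf{T}_Q^{C,\mathrm{II}}=\mathsf{D}^{-1}(\mathsf{T}_C^Q)^\top$, $\mathsf{R}^{(C)}_{\mathrm{II}}=\mathsf{T}_Q^{C,\mathrm{II}}\mathsf{T}_C^Q$ and $\langle\mathbf{x},\mathbf{y}\rangle_{\mathsf{D}}=\mathbf{x}^*\mathsf{D}\mathbf{y}$ be the associated objects defined in the context. If $$\langle\mathsf{S}^{(C)}\mathbf{w},\mathbf{w}\rangle_{\mathsf{D}}\notin(-\infty,0]\quad\text{for all nonzero }\mathbf{w}\in\operatorname{range}\mathsf{R}^{(C)}_{\mathrm{II}}\subset\mathbb{C}^{N_C},$$ then (with no smallness requirement on $h$) the preconditioner $$\mathsf{P}:=\mathsf{T}_C^Q\,\mathsf{S}^{(C)}\,\mathsf{T}_Q^{C,\mathrm{II}}+\bigl(\mathsf{I}_{N_Q}-\mathsf{T}_C^Q\,\mathsf{T}_Q^{C,\mathrm{II}}\bigr)\in\mathbb{C}^{N_Q\times N_Q}$$ is invertible.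
   Context: **Grid.** $\Omega\subset\mathbb{R}^2$ is open and bounded with piecewise smooth Lipschitz boundary, and $D$ is a rectangle with $\overline\Omega\subset D$. $D$ is tiled by the cells (closed axis-parallel squares of side $h_C>0$) of a uniform Cartesian grid, whose vertices are the nodes $z_1,\dots,z_{N_C}$. **Quadrature nodes.** $\mathcal{T}$ is a (possibly curved) triangulation of $\Omega$ with mesh size $h$ (maximal element diameter), carrying a quadrature rule whose nodes, collected over all elements, are $y_1,\dots,y_{N_Q}\in\Omega$. The triangulation enters the statement only through these nodes. **Transfer operators.** $\mathsf{T}_C^Q\in\mathbb{R}^{N_Q\times N_C}$ is bilinear interpolation: $(\mathsf{T}_C^Q)_{qj}=\psi_j(y_q)$, where $\psi_j(x)=\bigl(1-\tfrac{|x_1-z_{j,1}|}{h_C}\bigr)\bigl(1-\tfrac{|x_2-z_{j,2}|}{h_C}\bigr)$ for $x$ in a grid cell having $z_j$ as a vertex, and $\psi_j(x)=0$ otherwise. In particular every row of $\mathsf{T}_C^Q$ sums to one. $\mathsf{D}\in\mathbb{R}^{N_C\times N_C}$ is the diagonal matrix with $(\mathsf{D})_{jj}=\sum_{q=1}^{N_Q}(\mathsf{T}_C^Q)_{qj}$ if this column sum is positive (the pixelation nodes), and $(\mathsf{D})_{jj}=1$ otherwise. The Approach II (renormalized transpose) quadrature-to-Cartesian operator is $\mathsf{T}_Q^{C,\mathrm{II}}:=\mathsf{D}^{-1}(\mathsf{T}_C^Q)^\top\in\mathbb{R}^{N_C\times N_Q}$, and the round trip is $\mathsf{R}^{(C)}_{\mathrm{II}}:=\mathsf{T}_Q^{C,\mathrm{II}}\mathsf{T}_C^Q\in\mathbb{R}^{N_C\times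 N_C}$. **The matrix $\mathsf{S}^{(C)}$.** $\mathsf{S}^{(C)}\in\mathbb{C}^{N_C\times N_C}$ is a fixed matrix (the ''sparsifying preconditioner'', an approximate inverse of a Cartesian-grid discretization of the Lippmann–Schwinger equation). $\mathbf{x}^*$ is the conjugate transpose, and $\mathsf{I}_N$ is the $N\times N$ identity. *)

(* Defs.v *)
From HB Require Import structures.
From mathcomp Require Import all_boot all_order all_algebra.
From mathcomp Require Import complex.
From mathcomp Require Import all_classical all_reals all_analysis.

Set Implicit Arguments.
Unset Strict Implicit.
Unset Printing Implicit Defensive.

Import Order.TTheory GRing.Theory Num.Theory.
Import numFieldNormedType.Exports.

Local Open Scope classical_set_scope.
Local Open Scope ring_scope.

Section Plane.
Variable R : realType.
Implicit Types (A Omega : set (R * R)) (x y p : R * R).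

Definition edist x y : R :=
  Num.sqrt ((x.1 - y.1) ^+ 2 + (x.2 - y.2) ^+ 2).

Definition diameter A : R := sup [set edist x y | x in A & y in A].

Definition boundary A : set (R * R) := closure A `\` interior A.

(* The unit vector e fixes a rotated frame at p: the local coordinates of x
   are s (along e) and t (along e turned by a right angle), and inside a box of
   this frame Omega is the region strictly above a Lipschitz graph. *)
Definition lipschitz_boundary Omega : Prop :=
  forall p, boundary Omega p ->
  exists (e : R * R) (r k : R) (g : R -> R),
    [/\ e.1 ^+ 2 + e.2 ^+ 2 = 1, 0 < r, k.-lipschitz g
      & forall x,
        let s := e.1 * (x.1 - p.1) + e.2 * (x.2 - p.2) in
        let t := e.1 * (x.2 - p.2) - e.2 * (x.1 - p.1) in
        `|s| < r -> `|t| < r -> (Omega x <-> g s < t)].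

(* A finite union of regular C^1 arcs, each parametrized by [0, 1]; a C^1 map
   on [0, 1] is the restriction of a C^1 map on the line. *)
Definition piecewise_smooth_boundary Omega : Prop :=
  exists (n : nat) (c1 c2 : 'I_n -> R -> R),
    [/\ forall i t, derivable (c1 i) t 1 /\ derivable (c2 i) t 1,
        forall i, continuous (derive1 (c1 i)) /\ continuous (derive1 (c2 i)),
        forall i t, 0 <= t <= 1 -> (derive1 (c1 i) t, derive1 (c2 i) t) <> (0, 0)
      & boundary Omega =
        \bigcup_(i in [set: 'I_n]) [set (c1 i t, c2 i t) | t in `[0, 1] ] ].

End Plane.

Section Triangulation.
Variable R : realType.

Definition barycentric (x : R * R) (i : 'I_3) : R :=
  nth 0 [:: 1 - x.1 - x.2; x.1; x.2] i.

Definition ref_triangle : set (R * R) :=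
  [set x | forall i, 0 <= barycentric x i].

(* The three edges and the three vertices. *)
Definition ref_faces : set (set (R * R)) :=
  [set f | exists i, f = [set x | ref_triangle x /\ barycentric x i = 0]
                  \/ f = [set x | ref_triangle x /\ barycentric x i = 1]].

(* Elements are curved triangles, given as homeomorphic images of the reference
   triangle (a continuous injection on a compact set is a homeomorphism onto
   its image).  By conformity two distinct elements meet only along faces
   (vertices or edges) which they have in common. *)
Record triangulation (Omega : set (R * R)) := Triangulation {
  nelts : nat;
  emap : 'I_nelts -> R * R -> R * R;
  emap_continuous : forall i, {within ref_triangle, continuous (emap i)};
  emap_injective : forall i, {in ref_triangle &, injective (emap i)};
  emap_cover :
    \bigcup_(i in [set: 'I_nelts]) (emap i @` ref_triangle) = closure Omega;
  emap_conforming : forall i j, i != j -> forall x,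
    (emap i @` ref_triangle) x -> (emap j @` ref_triangle) x ->
    exists f g, [/\ ref_faces f, ref_faces g,
                    emap i @` f = emap j @` g & (emap i @` f) x] }.

Definition elt (Omega : set (R * R)) (T : triangulation Omega)
  (i : 'I_(nelts T)) : set (R * R) := emap i @` ref_triangle.

(* Diameters are nonnegative, so the default value 0 is harmless. *)
Definition mesh_size (Omega : set (R * R)) (T : triangulation Omega) : R :=
  \big[Num.max/0]_(i < nelts T) diameter (elt i).

(* All nodes of all elements, numbered together; qelt gives the element to
   which a node belongs. *)
Record quadrature (Omega : set (R * R)) (T : triangulation Omega) (NQ : nat) :=
  Quadrature {
    qelt : 'I_NQ -> 'I_(nelts T);
    qnode : 'I_NQ -> R * R;
    qweight : 'I_NQ -> R;
    qnode_elt : forall q, elt (qelt q) (qnode q);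
    qnode_dom : forall q, Omega (qnode q) }.

End Triangulation.

Section Grid.
Variable R : realType.

Record cartesian_grid := CartesianGrid {
  gorigin : R * R;
  gstep : R;
  gnx : nat;
  gny : nat;
  gstep_gt0 : 0 < gstep;
  gnx_gt0 : (0 < gnx)%N;
  gny_gt0 : (0 < gny)%N }.

Variable G : cartesian_grid.

Definition gpoint (k l : nat) : R * R :=
  ((gorigin G).1 + k%:R * gstep G, (gorigin G).2 + l%:R * gstep G).

Definition box (a b : R * R) : set (R * R) := `[a.1, b.1] `*` `[a.2, b.2].

Definition grid_rectangle : set (R * R) :=
  box (gpoint 0 0) (gpoint (gnx G) (gny G)).

Definition grid_nodes : set (R * R) :=
  [set p | exists k l, [/\ (k <= gnx G)%N, (l <= gny G)%N & p = gpoint k l]].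

Definition grid_cell (k l : nat) : set (R * R) :=
  box (gpoint k l) (gpoint k.+1 l.+1).

Definition cell_vertices (k l : nat) : set (R * R) :=
  [set gpoint k l; gpoint k.+1 l; gpoint k l.+1; gpoint k.+1 l.+1].

Definition share_cell (z x : R * R) : Prop :=
  exists k l, [/\ (k < gnx G)%N, (l < gny G)%N,
                  cell_vertices k l z & grid_cell k l x].

(* The bilinear hat function of the node z. *)
Definition hat (z x : R * R) : R :=
  if `[< share_cell z x >] then
    (1 - `|x.1 - z.1| / gstep G) * (1 - `|x.2 - z.2| / gstep G)
  else 0.

End Grid.

Section Transfer.
Variables (R : realType) (G : cartesian_grid R) (NC NQ : nat).
Variables (z : 'I_NC -> R * R) (y : 'I_NQ -> R * R).

Definition TCQ : 'M[R]_(NQ, NC) := \matrix_(q, j) hat G (z j) (y q).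

Definition colsum (j : 'I_NC) : R := \sum_q TCQ q j.

Definition Dmx : 'M[R]_NC :=
  diag_mx (\row_j (if 0 < colsum j then colsum j else 1)).

Definition TQC_II : 'M[R]_(NC, NQ) := invmx Dmx *m TCQ^T.

Definition RC_II : 'M[R]_NC := TQC_II *m TCQ.

End Transfer.

Section ComplexMatrices.
Variable R : realType.

(* A real matrix seen as a complex one. *)
Definition cplx m n (A : 'M[R]_(m, n)) : 'M[R[i]]_(m, n) :=
  map_mx (real_complex R) A.

Definition conjtr m n (A : 'M[R[i]]_(m, n)) : 'M[R[i]]_(n, m) :=
  map_mx Num.conj A^T.

Definition dotD n (D : 'M[R]_n) (u v : 'cV[R[i]]_n) : R[i] :=
  (conjtr u *m cplx D *m v) 0 0.

Definition mx_range m n (A : 'M[R[i]]_(m, n)) : set 'cV[R[i]]_m :=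
  [set A *m v | v in [set: 'cV[R[i]]_n]].

(* The half-line (-oo, 0] as a subset of the complex plane. *)
Definition nonpos_ray : set R[i] :=
  [set real_complex R t | t in `]-oo, 0] ].

End ComplexMatrices.

Definition preconditioner (R : realType) (G : cartesian_grid R) (NC NQ : nat)
    (z : 'I_NC -> R * R) (S : 'M[R[i]]_NC) (y : 'I_NQ -> R * R)
    : 'M[R[i]]_NQ :=
  cplx (TCQ G z y) *m S *m cplx (TQC_II G z y)
  + (1%:M - cplx (TCQ G z y) *m cplx (TQC_II G z y)).

(* Main.v *)
(* Write A for T_C^Q, B = D^-1 A^T and let P v = 0. With u = B v this reads
   v = A (u - S u), so u = B A (u - S u) lies in the range of the round trip,
   and D B = A^T gives <S u, u>_D = <u, u>_D - |v|^2. The hat functions are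
   nonnegative with sum at most one, so by Jensen |A u|^2 <= <u, u>_D; expanding
   0 <= |v - A u|^2 then yields <u, u>_D <= |v|^2. Hence <S u, u>_D <= 0, which
   forces u = 0 and v = 0. *)
Require Import Defs.
From HB Require Import structures.
From mathcomp Require Import all_boot all_order all_algebra.
From mathcomp Require Import complex.
From mathcomp Require Import ring lra.
From mathcomp Require Import all_classical all_reals all_analysis.

Import Order.TTheory GRing.Theory Num.Theory.
Import numFieldNormedType.Exports.

Local Open Scope classical_set_scope.
Local Open Scope ring_scope.

(** * Bilinear hat functions: nonnegativity and row sums *)

Section HatSums.
Variable R : realType.

Definition tent (t : R) : R := Num.max 0 (1 - `|t|).

Lemma tent_ge0 (t : R) : 0 <= tent t.
Proof. by rewrite /tent le_max lexx. Qed.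

(* The sharper right-hand side, the sum of all tents centred below [n], makes
   the induction go through. *)
Lemma sum_tent_le_clamp (n : nat) (s : R) :
  \sum_(k < n) tent (s - k%:R) <= Num.min 1 (Num.max 0 (n%:R - s)).
Proof.
elim: n => [|n IHn].
  by rewrite big_ord0 le_min ler01 le_max lexx.
rewrite big_ord_recr /=; apply: (le_trans (lerD IHn (lexx _))).
rewrite /tent -natr1; set c := n%:R; clearbody c.
(* For [s >= c] the old clamp is 0 and the new tent equals the new clamp; for [s <= c] the old clamp
   and the new tent add up to 1. *)
by case: (ger0P (s - c)) => ?;
  case: (leP 0 (c - s)) => ?; case: (leP 0 (c + 1 - s)) => ?;
  case: (leP 0 (1 - _)) => ?; do !case: (leP 1 _) => ?; lra.
Qed.

Lemma sum_tent_le1 (n : nat) (s : R) : \sum_(k < n) tent (s - k%:R) <= 1.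
Proof. by apply: (le_trans (sum_tent_le_clamp n s)); rewrite ge_min lexx. Qed.

Variable G : cartesian_grid R.

Lemma share_cell_dist (z x : R * R) : share_cell G z x ->
  `|x.1 - z.1| / gstep G <= 1 /\ `|x.2 - z.2| / gstep G <= 1.
Proof.
have h0 := gstep_gt0 G.
move=> [k [l [_ _ vz [/= x1 x2]]]].
move: x1 x2; rewrite /gpoint /= !in_itv /= -!natr1 !mulrDl !mul1r.
move=> /andP[x1l x1r] /andP[x2l x2r].
rewrite !ler_pdivrMr // !mul1r !ler_norml.
by move: vz => [[[->|->]|->]|->] /=; rewrite -?natr1 ?mulrDl ?mul1r;
  split; apply/andP; split; lra.
Qed.

Lemma hat_ge0 (z x : R * R) : 0 <= hat G z x.
Proof.
rewrite /hat; case: asboolP => // /share_cell_dist[h1 h2].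
by apply: mulr_ge0; rewrite subr_ge0.
Qed.

(** In grid coordinates the two factors of the hat are the untruncated tents. On a shared cell they
    are nonnegative, so the bounds multiply; elsewhere the hat is 0. *)
Lemma hat_gpoint_le (k l : nat) (x : R * R) :
  hat G (gpoint G k l) x <=
  tent ((x.1 - (gorigin G).1) / gstep G - k%:R) *
  tent ((x.2 - (gorigin G).2) / gstep G - l%:R).
Proof.
have h0 := gstep_gt0 G.
have dist (a o : R) (m : nat) :
    `|a - (o + m%:R * gstep G)| / gstep G = `|(a - o) / gstep G - m%:R|.
  rewrite -{2}(gtr0_norm h0) -normf_div; congr (`| _ |).
  by field; rewrite gt_eqF.
rewrite /hat; case: asboolP => [/share_cell_dist[]|_]; last first.
  by rewrite mulr_ge0 ?tent_ge0.
rewrite /gpoint /= !dist => h1 h2.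
by rewrite ler_pM ?subr_ge0 //; rewrite /tent le_max lexx orbT.
Qed.

(** Distinct nodes have distinct index pairs, so the tent products of the nodes form a subsum of the
    nonnegative sum over all pairs, which factors into two one-dimensional tent sums. *)
Lemma sum_hat_le1 (NC : nat) (z : 'I_NC -> R * R) (x : R * R) :
  injective z -> (forall j, grid_nodes G (z j)) ->
  \sum_j hat G (z j) x <= 1.
Proof.
move=> zinj znode.
have /choice[f fP] j : exists p : 'I_(gnx G).+1 * 'I_(gny G).+1,
    z j = gpoint G p.1 p.2.
  have [k [l [kn ln ->]]] := znode j.
  have kn' : (k < (gnx G).+1)%N by [].
  have ln' : (l < (gny G).+1)%N by [].
  by exists (Ordinal kn', Ordinal ln').
have finj : injective f by move=> i j fij; apply: zinj; rewrite !fP fij.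
pose s1 := (x.1 - (gorigin G).1) / gstep G.
pose s2 := (x.2 - (gorigin G).2) / gstep G.
pose F (p : 'I_(gnx G).+1 * 'I_(gny G).+1) :=
  tent (s1 - p.1%:R) * tent (s2 - p.2%:R).
have F0 p : 0 <= F p by rewrite mulr_ge0 ?tent_ge0.
apply: (@le_trans _ _ (\sum_j F (f j))).
  by apply: ler_sum => j _; rewrite fP hat_gpoint_le.
apply: (@le_trans _ _ (\sum_p F p)).
  have -> : \sum_j F (f j) = \sum_(p in f @: [set: 'I_NC]%SET) F p.
    rewrite big_imset /=; last by move=> i j _ _; exact: finj.
    by apply: eq_bigl => j; rewrite inE.
  by rewrite [leRHS](bigID (mem (f @: [set: 'I_NC]%SET))) /= lerDl sumr_ge0.
rewrite -(pair_bigA _ (fun i j => F (i, j))) /= /F /=.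
under eq_bigr do rewrite -mulr_sumr.
rewrite -mulr_suml mulr_ile1 ?sumr_ge0 // ?sum_tent_le1 //.
- by move=> *; exact: tent_ge0.
- by move=> *; exact: tent_ge0.
Qed.

End HatSums.

(** * Conjugate transposes and the order on complex numbers *)

Section ComplexAlgebra.
Variable R : realType.
Local Notation C := R[i].

Lemma conjtrM m n p (A : 'M[C]_(m, n)) (B : 'M[C]_(n, p)) :
  conjtr (A *m B) = conjtr B *m conjtr A.
Proof. by rewrite /conjtr trmx_mul map_mxM. Qed.

Lemma conjtrB m n (A B : 'M[C]_(m, n)) : conjtr (A - B) = conjtr A - conjtr B.
Proof. by apply/matrixP => i j; rewrite !mxE rmorphB. Qed.

Lemma conjtrK m n (A : 'M[C]_(m, n)) : conjtr (conjtr A) = A.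
Proof. by apply/matrixP => i j; rewrite !mxE conjCK. Qed.

Lemma conjtr_cplx m n (A : 'M[R]_(m, n)) : conjtr (cplx A) = cplx A^T.
Proof.
by apply/matrixP => i j; rewrite !mxE conj_Creal // complex_real.
Qed.

Lemma cplxM m n p (A : 'M[R]_(m, n)) (B : 'M[R]_(n, p)) :
  cplx (A *m B) = cplx A *m cplx B.
Proof. exact: map_mxM. Qed.

Lemma entryB m n (A B : 'M[C]_(m, n)) i j : (A - B) i j = A i j - B i j.
Proof. by rewrite !mxE. Qed.

Lemma dotDBl n (D : 'M[R]_n) (u v w : 'cV[C]_n) :
  dotD D (u - v) w = dotD D u w - dotD D v w.
Proof. by rewrite /dotD conjtrB !mulmxBl entryB. Qed.

Lemma sqnormE n (v : 'cV[C]_n) :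
  (conjtr v *m v) 0 0 = \sum_i `|v i 0| ^+ 2.
Proof. by rewrite mxE; apply: eq_bigr => i _; rewrite !mxE mulrC normCK. Qed.

(** The order of [R[i]] relates only numbers with equal imaginary parts, so [c <= 0] already makes
    [c] real. *)
Lemma nonpos_rayE (c : C) : c <= 0 -> nonpos_ray c.
Proof.
case: c => a b; rewrite lecE /= => /andP[/eqP b0 a0].
by exists a; rewrite /= ?in_itv //= -b0.
Qed.

End ComplexAlgebra.

(* Expand [0 <= sum_j a_j |u_j - s|^2] with [s = sum_j a_j u_j]. *)
Lemma sqr_norm_subconvex_le (C : numClosedFieldType) (n : nat)
    (a u : 'I_n -> C) :
  (forall j, 0 <= a j) -> \sum_j a j <= 1 ->
  `|\sum_j a j * u j| ^+ 2 <= \sum_j a j * `|u j| ^+ 2.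
Proof.
move=> a0 a1; set s := \sum_j a j * u j.
have conj_s : s^* = \sum_j a j * (u j)^*.
  rewrite rmorph_sum; apply: eq_bigr => j _.
  by rewrite rmorphM /= (conj_Creal (ger0_real (a0 j))).
have pos : 0 <= \sum_j a j * `|u j - s| ^+ 2.
  by apply: sumr_ge0 => j _; rewrite mulr_ge0 ?exprn_ge0.
have expand : \sum_j a j * `|u j - s| ^+ 2 =
    \sum_j a j * `|u j| ^+ 2 - `|s| ^+ 2 - `|s| ^+ 2
    + (\sum_j a j) * `|s| ^+ 2.
  transitivity (\sum_j (a j * `|u j| ^+ 2 - (a j * u j) * s^*
                  - (a j * (u j)^* ) * s + a j * `|s| ^+ 2)).
    by apply: eq_bigr => j _; rewrite !normCK rmorphB /=; ring.
  rewrite !(big_split, sumrN) /= -!mulr_suml -/s -conj_s.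
  by rewrite -normCK [s^* * s]mulrC -normCK.
have small : (\sum_j a j) * `|s| ^+ 2 <= `|s| ^+ 2.
  by rewrite ler_piMl ?exprn_ge0.
rewrite -subr_ge0; apply: (le_trans pos); rewrite expand.
by rewrite -addrA gerDl addrC subr_le0.
Qed.

(** * Energy estimates for a nonnegative matrix and its renormalized transpose *)

Section RoundTrip.
Variables (R : realType) (m n : nat) (A : 'M[R]_(m, n)) (d : 'rV[R]_n).
Hypothesis A_ge0 : forall q j, 0 <= A q j.
Hypothesis row_le1 : forall q, \sum_j A q j <= 1.
Hypothesis d_gt0 : forall j, 0 < d 0 j.
Hypothesis col_le : forall j, \sum_q A q j <= d 0 j.

Local Notation D := (diag_mx d).
Local Notation B := (invmx D *m A^T).

Lemma diag_unit : D \in unitmx.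
Proof.
rewrite unitmxE det_diag unitfE; apply/prodf_neq0 => i _.
by rewrite gt_eqF.
Qed.

Lemma dotD_diagE (u : 'cV[R[i]]_n) :
  dotD D u u = \sum_j real_complex R (d 0 j) * `|u j 0| ^+ 2.
Proof.
rewrite /dotD mxE; apply: eq_bigr => j _.
rewrite mxE (bigD1 j) //= big1 => [|k kj].
  by rewrite !mxE eqxx mulr1n addr0 normCK; ring.
by rewrite !mxE (negPf kj) mulr0n rmorph0 mulr0.
Qed.

Lemma sqnorm_mul_le_dotD (u : 'cV[R[i]]_n) :
  (conjtr (cplx A *m u) *m (cplx A *m u)) 0 0 <= dotD D u u.
Proof.
rewrite sqnormE dotD_diagE.
apply: (@le_trans _ _ (\sum_q \sum_j real_complex R (A q j) * `|u j 0| ^+ 2)).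
  apply: ler_sum => q _; rewrite mxE.
  under eq_bigr do rewrite mxE.
  apply: sqr_norm_subconvex_le => [j|]; first by rewrite ler0c.
  by rewrite -rmorph_sum -(rmorph1 (real_complex R)) lecR.
(* Now the weight of the squared modulus of [u j 0] is the column sum of [A], which [col_le] bounds
   by [d 0 j]. *)
rewrite exchange_big /=; apply: ler_sum => j _.
by rewrite -mulr_suml -rmorph_sum ler_wpM2r ?exprn_ge0 // lecR.
Qed.

(** The weight [D] cancels the inverse inside [B], which makes [B] the adjoint of [A] between the
    Euclidean and the weighted product. *)
Lemma dotD_adjoint (w : 'cV[R[i]]_n) (v : 'cV[R[i]]_m) :
  dotD D w (cplx B *m v) = (conjtr (cplx A *m w) *m v) 0 0.
Proof.
rewrite /dotD conjtrM conjtr_cplx cplxM -!mulmxA (mulmxA (cplx D)) -cplxM.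
by rewrite mulmxV ?diag_unit // /cplx map_mx1 mul1mx.
Qed.

Lemma dotD_roundtrip_le (v : 'cV[R[i]]_m) :
  dotD D (cplx B *m v) (cplx B *m v) <= (conjtr v *m v) 0 0.
Proof.
set u := cplx B *m v.
have cross1 : (conjtr (cplx A *m u) *m v) 0 0 = dotD D u u.
  by rewrite -dotD_adjoint.
(* This is the conjugate of the first cross term, which is real as a sum of real weights times
   squared moduli. *)
have cross2 : (conjtr v *m (cplx A *m u)) 0 0 = dotD D u u.
  transitivity (Num.conj ((conjtr (cplx A *m u) *m v) 0 0)).
    by rewrite -[X in _ *m X]conjtrK -conjtrM !mxE.
  rewrite cross1 dotD_diagE rmorph_sum; apply: eq_bigr => j _.
  by apply/conj_Creal/realM; rewrite ?realX ?normr_real ?complex_real.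
have : 0 <= (conjtr (v - cplx A *m u) *m (v - cplx A *m u)) 0 0.
  by rewrite sqnormE sumr_ge0 // => i _; rewrite exprn_ge0.
rewrite conjtrB mulmxBl !mulmxBr.
rewrite !entryB cross1 cross2 => /le_trans pos.
rewrite -subr_ge0; apply: pos.
by rewrite -addrA lerD2l opprB gerDl subr_le0 sqnorm_mul_le_dotD.
Qed.

Lemma preconditioner_unit (S : 'M[R[i]]_n) :
  (forall w : 'cV[R[i]]_n, mx_range (cplx (B *m A)) w -> w <> 0 ->
     ~ nonpos_ray (dotD D (S *m w) w)) ->
  cplx A *m S *m cplx B + (1%:M - cplx A *m cplx B) \in unitmx.
Proof.
(* Row freeness of the transpose turns the goal into a trivial kernel on column vectors. *)
move=> HS; rewrite -unitmx_tr -row_free_unit; apply: inj_row_free => vt.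
move=> /(congr1 trmx); rewrite trmx_mul trmxK trmx0.
rewrite -[vt]trmxK; move: vt^T => v; rewrite trmxK => Pv0.
pose u := cplx B *m v.
have vE : v = cplx A *m (u - S *m u).
  apply/eqP; rewrite -subr_eq0 -[X in _ == X]Pv0; apply/eqP.
  rewrite mulmxDl mulmxBl mul1mx mulmxBr /u !mulmxA.
  by rewrite opprB addrCA.
suff u0 : u = 0 by rewrite vE u0 mulmx0 subr0 mulmx0 trmx0.
apply: contrapT => un0; apply: (HS u _ un0).
  by exists (u - S *m u); rewrite // cplxM -mulmxA -vE.
apply: nonpos_rayE.
have -> : dotD D (S *m u) u = dotD D u u - (conjtr v *m v) 0 0.
  (* Adjointness applies because one factor [v] is the [A]-image of [u - S *m u] and [u] is the
     [B]-image of the other. *)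
  have -> : (conjtr v *m v) 0 0 = dotD D (u - S *m u) u.
    by rewrite dotD_adjoint -vE.
  by rewrite dotDBl opprB addrC subrK.
by rewrite subr_le0 dotD_roundtrip_le.
Qed.

End RoundTrip.

Theorem theorem5p8 (R : realType) (Omega : set (R * R))
    (G : cartesian_grid R) (NC : nat) (z : 'I_NC -> R * R)
    (S : 'M[R[i]]_NC)
    (h : R) (T : triangulation Omega) (NQ : nat) (Q : quadrature T NQ) :
  open Omega -> bounded_set Omega ->
  lipschitz_boundary Omega -> piecewise_smooth_boundary Omega ->
  closure Omega `<=` grid_rectangle G ->
  set_bij [set: 'I_NC] (grid_nodes G) z ->
  0 < h -> mesh_size T = h ->
  (forall w : 'cV[R[i]]_NC,
     mx_range (cplx (RC_II G z (qnode Q))) w -> w <> 0 ->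
     ~ nonpos_ray (R := R) (dotD (Dmx G z (qnode Q)) (S *m w) w)) ->
  preconditioner G z S (qnode Q) \in unitmx.
Proof.
move=> _ _ _ _ _ [zin zinj _] _ _ HS.
apply: preconditioner_unit HS.
- by move=> q j; rewrite mxE hat_ge0.
- move=> q; under eq_bigr do rewrite mxE.
  apply: sum_hat_le1 => [i j|j]; last exact: zin.
  by apply: zinj; rewrite inE.
- by move=> j; rewrite mxE; case: ifP.
(* Where the column sum is not positive, the default entry 1 of [Dmx] still dominates it. *)
- move=> j; rewrite mxE -/(colsum _ _ _ j); case: ltP => // /le_trans; apply.
  exact: ler01.
Qed.
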